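(* For Lebesgue almost every angle $\alpha\in\mathbb{T}$ the following two properties hold simultaneously: (1) for every irrational point $\xi\in\alpha+K$, one has $2\leq\mu(\xi)\leq\frac{2}{1-\kappa}$; (2) for every real number $\mu\in[2,2/(1-\kappa)]$, one has $\dim_H(\mathcal{M}(\mu)\cap(\alpha+K))\leq\frac{2}{\mu}+\kappa-1$.
   Context: $\mathbb{T}=\mathbb{R}/\mathbb{Z}$ is the circle with the usual quotient distance $d$, identified with $[0,1)$. $K$ denotes the image in $\mathbb{T}$ of the middle-third Cantor set $\{\sum_{i\ge1}a_i3^{-i}: a_i\in\{0,2\}\}$, and $\kappa=\log 2/\log 3$. For $\alpha\in\mathbb{T}$, $\alpha+K$ is the image of $K$ under the rotation by $\alpha$. Let $\mathcal{P}$ be the set of pairs $(p,q)$ of integers with $0\le p<q$ and $\gcd(p,q)=1$. For an irrational $\xi\in\mathbb{T}$, its irrationality exponent is $\mu(\xi)=\sup\{\mu\in\mathbb{R}: d(\xi,p/q)<q^{-\mu}\text{ for infinitely many }(p,q)\in\mathcal{P}\}$; for rational $\xi$, $\mu(\xi)=1$. For $\mu\ge2$, $\mathcal{M}(\mu)=\{\xi\in\mathbb{T}:\mu(\xi)\geq\mu\}$. $\dim_H$ denotes Hausdorff dimension, with the convention $\dim_H\emptyset=-\infty$. *)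

(* Defs.v *)
(* R : realType, the circle T = R/Z modelled by [0,1). *)
From HB Require Import structures.
From mathcomp Require Import all_boot all_order all_algebra.
From mathcomp Require Import all_classical all_reals all_analysis.
Set Implicit Arguments. Unset Strict Implicit. Unset Printing Implicit Defensive.
Import Order.TTheory GRing.Theory Num.Theory.
Import numFieldNormedType.Exports.
Local Open Scope classical_set_scope.
Local Open Scope ring_scope.

Section Defs.
Variable R : realType.

(* canonical projection R -> T = [0,1) *)
Definition frac (x : R) : R := x - (Num.floor x)%:~R.

(* quotient distance on T: d(x,y) = min_{n in Z} |x - y - n| *)
Definition tdist (x y : R) : R := Num.min (frac (x - y)) (1 - frac (x - y)).

Definition cantor : set R :=
  [set x | exists a : nat -> bool,
     (fun n => \sum_(i < n) (((a i)%:R *+ 2) / 3 ^+ i.+1)) @ \oo --> x].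

Definition cantorT : set R := frac @` cantor.

Definition rotCantor (alpha : R) : set R := [set frac (alpha + k) | k in cantorT].

Definition kappa : R := ln 2 / ln 3.

Definition is_rational (x : R) : Prop :=
  exists (p : int) (q : nat), (0 < q)%N /\ x = p%:~R / q%:R.

Definition good_pairs (xi mu : R) : set (nat * nat) :=
  [set pq | (pq.1 < pq.2)%N /\ coprime pq.1 pq.2 /\
            tdist xi (pq.1%:R / pq.2%:R) < (pq.2%:R) `^ (- mu)].

Definition irr_exp (xi : R) : \bar R :=
  if pselect (is_rational xi) then 1%:E
  else ereal_sup [set mu%:E | mu in [set mu | infinite_set (good_pairs xi mu)]].

Definition Mset (mu : R) : set R :=
  [set xi | 0 <= xi < 1 /\ (mu%:E <= irr_exp xi)%E].

Definition tdiam (U : set R) : R := sup [set tdist x y | x in U & y in U].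

Definition cover_term (s : R) (U : set R) : R :=
  if pselect (U = set0) then 0 else tdiam U `^ s.

Definition hausdorff_delta (s delta : R) (A : set R) : \bar R :=
  ereal_inf [set (\sum_(0 <= i <oo) (cover_term s (F i))%:E)%E
            | F in [set F : nat -> set R |
                     A `<=` \bigcup_i F i /\ forall i, tdiam (F i) <= delta]].

Definition hausdorff (s : R) (A : set R) : \bar R :=
  ereal_sup [set hausdorff_delta s delta A | delta in [set delta : R | 0 < delta]].

Definition hdim (A : set R) : \bar R :=
  if pselect (A = set0) then -oo%E
  else ereal_inf [set s%:E | s in [set s : R | 0 <= s /\ hausdorff s A = 0%E]].

End Defs.

(* Main.v *)
(* For [mu > 0], the angles [alpha] for which [alpha + K] meets the ball
   B(p/q, q^-mu) form a set of measure O(q^-(mu (1 - kappa))): cover K by 2^n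
   intervals of length 3^-n with 3^n ~ q^mu. If [mu (s + 1 - kappa) > 2], the
   sum over [p < q] of [q^-(mu s)] weighted by these measures converges, so
   that for almost every [alpha] the sum of [q^-(mu s)] over the balls met by
   [alpha + K] is finite. For [s = 0] only finitely many balls are met, which
   bounds the irrationality exponent; for [s > 0] the tails of this sum bound
   the s-dimensional Hausdorff measure of the points of [alpha + K] lying in
   infinitely many balls. Rational [mu] and [s] suffice, so a single null set
   of angles has to be excluded. *)
Require Import Defs.
From HB Require Import structures.
From mathcomp Require Import all_boot all_order all_algebra.
From mathcomp Require Import all_classical all_reals all_analysis.
From mathcomp Require Import measurable_realfun.
From mathcomp Require Import ring lra zify.
Set Implicit Arguments. Unset Strict Implicit. Unset Printing Implicit Defensive.
Import Order.TTheory GRing.Theory Num.Theory.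
Import numFieldNormedType.Exports.
Local Open Scope classical_set_scope.
Local Open Scope ring_scope.
Local Notation frac := Defs.frac.

(** * The constant [kappa] as the exponent with 3^kappa = 2 *)

Section Kappa.
Variable R : realType.

Lemma ln2_gt0 : 0 < ln 2 :> R.
Proof. by rewrite ln_gt0// ltr1n. Qed.

Lemma ln3_gt0 : 0 < ln 3 :> R.
Proof. by rewrite ln_gt0// ltr1n. Qed.

Lemma kappa_ge0 : 0 <= kappa R.
Proof. by rewrite /kappa divr_ge0// ltW// ?ln2_gt0 ?ln3_gt0. Qed.

Lemma kappa_lt1 : kappa R < 1.
Proof.
by rewrite /kappa ltr_pdivrMr ?ln3_gt0// mul1r ltr_ln ?posrE// ltr_nat.
Qed.

Lemma powR3_kappa : 3 `^ kappa R = 2.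
Proof.
rewrite /powR pnatr_eq0/= /kappa mulfVK ?gt_eqF ?ln3_gt0//.
by rewrite lnK ?posrE.
Qed.

End Kappa.

(** * Distance and diameter on the circle *)

Section CircleDistance.
Variable R : realType.
Implicit Types x y z : R.

Lemma frac_ge0_lt1 x : 0 <= frac x < 1.
Proof.
rewrite /frac subr_ge0 ge_floor/= ltrBlDr addrC.
by have := floorD1_gt x; rewrite intrD.
Qed.

(** Any translate of x - y is f + m with f its fractional part: it is at least f if m >= 0, and at
    most f - 1 < 0 if m <= -1. With [tdistE], this turns [tdist] into a minimum over integers. *)
Lemma tdist_le x y (n : int) : tdist x y <= `|x - y - n%:~R|.
Proof.
rewrite /tdist; have /andP[f0 f1] := frac_ge0_lt1 (x - y).
set f := frac (x - y) in f0 f1 *.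
have -> : x - y - n%:~R = f + (Num.floor (x - y) - n)%:~R.
  by rewrite /f /frac intrD rmorphN/=; ring.
set m : int := Num.floor _ - _.
have [m0|m0] := leP 0 m.
  have m0R : 0 <= m%:~R :> R by rewrite ler0z.
  by rewrite ge_min (ger0_norm (addr_ge0 f0 m0R)) lerDl m0R.
have m1R : m%:~R <= -1 :> R by rewrite -[-1]/((-1)%:~R) ler_int; lia.
rewrite ge_min; apply/orP; right; rewrite ler0_norm; lra.
Qed.

Lemma tdistE x y : exists n : int, tdist x y = `|x - y - n%:~R|.
Proof.
rewrite /tdist; have /andP[f0 f1] := frac_ge0_lt1 (x - y).
case: (leP (frac (x - y)) (1 - frac (x - y))) => _.
  by exists (Num.floor (x - y)); rewrite -/(frac _) ger0_norm.
exists (Num.floor (x - y) + 1); rewrite intrD.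
have -> : x - y - ((Num.floor (x - y))%:~R + 1) = - (1 - frac (x - y)).
  by rewrite /frac; ring.
by rewrite normrN ger0_norm// subr_ge0 ltW.
Qed.

Lemma tdist_ge0 x y : 0 <= tdist x y.
Proof. by have [n ->] := tdistE x y. Qed.

Lemma tdist_le1 x y : tdist x y <= 1.
Proof.
have /andP[f0 f1] := frac_ge0_lt1 (x - y).
by rewrite /tdist ge_min (ltW f1).
Qed.

Lemma tdist_triangle z x y : tdist x y <= tdist x z + tdist y z.
Proof.
have [n ->] := tdistE x z; have [m ->] := tdistE y z.
apply: le_trans (tdist_le x y (n - m)) _.
have -> : x - y - (n - m)%:~R = (x - z - n%:~R) - (y - z - m%:~R).
  by rewrite intrD rmorphN/=; ring.
exact: ler_normB.
Qed.

Lemma tdiam_ge0 (U : set R) : 0 <= tdiam U.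
Proof.
rewrite /tdiam; set D := (X in sup X).
(* The empty set has diameter 0, through the default value [sup set0 = 0]. *)
have [->|/set0P[d Dd]] := eqVneq D set0; first by rewrite sup0.
have d0 : 0 <= d by case: Dd => x _ [y _ <-]; exact: tdist_ge0.
apply: le_trans d0 _; apply: ub_le_sup Dd.
by exists 1 => _ [x _ [y _ <-]]; exact: tdist_le1.
Qed.

Lemma tdiam_le (U : set R) d : 0 <= d ->
  (forall x y, U x -> U y -> tdist x y <= d) -> tdiam U <= d.
Proof.
move=> d0 Ud; rewrite /tdiam; set D := (X in sup X).
have [->|/set0P D0] := eqVneq D set0; first by rewrite sup0.
by apply: ge_sup => // _ [x Ux [y Uy <-]]; exact: Ud.
Qed.

Lemma tdiam_set0 : tdiam (set0 : set R) = 0.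
Proof. by apply/eqP; rewrite eq_le tdiam_ge0 andbT tdiam_le. Qed.

Lemma cover_term_ge0 s (U : set R) : 0 <= cover_term s U.
Proof. by rewrite /cover_term; case: pselect => // ?; exact: powR_ge0. Qed.

Lemma cover_term_set0 s : cover_term s (set0 : set R) = 0.
Proof. by rewrite /cover_term; case: pselect. Qed.

End CircleDistance.

(** * Coverings of the Cantor set by triadic intervals *)

Section CantorCover.
Variable R : realType.

Lemma cantor_itv (k : R) : cantor k -> 0 <= k <= 1.
Proof.
case=> a ak.
(* The upper bound is the partial sum with all digits equal to 2. *)
have S01 n : 0 <= (\sum_(i < n) (((a i)%:R *+ 2) / 3 ^+ i.+1) : R) <= 1 - 3^-1 ^+ n.
  elim: n => [|n /andP[IH0 IH1]]; first by rewrite big_ord0 expr0 subrr lexx.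
  rewrite big_ord_recr/= -exprVn.
  have e0 : 0 <= 3^-1 ^+ n :> R by rewrite exprn_ge0// invr_ge0.
  rewrite exprS; set e := 3^-1 ^+ n in e0 IH1 *.
  have a01 : 0 <= ((a n)%:R : R) <= 1 by case: (a n); rewrite /= ?lexx ?ler01.
  have := mulr_ge0 (proj1 (andP a01)) e0.
  have : (a n)%:R * e <= e by rewrite ler_piMl//; case/andP: a01.
  set b : R := (a n)%:R in a01 *.
  have -> : b *+ 2 * (3^-1 * e) = (2/3) * (b * e) by rewrite mulr2n; field.
  by move=> ? ?; apply/andP; split; lra.
apply/andP; split.
  by apply: (cvgr_to_ge ak); apply: nearW => n; case/andP: (S01 n).
apply: (cvgr_to_le ak); apply: nearW => n.
have /andP[_ Sn1] := S01 n.
by apply: (le_trans Sn1); rewrite gerBl exprn_ge0// invr_ge0.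
Qed.

(** Self-similarity: removing the first ternary digit of k shifts the digit sequence and yields 3k -
    2a_0, again in the Cantor set. *)
Lemma cantor_tail (k : R) : cantor k ->
  exists2 k', cantor k' & k = k' / 3 \/ k = (k' + 2) / 3.
Proof.
case=> a ak; exists (3 * k - (a 0%N)%:R *+ 2).
  exists (fun n => a n.+1).
  have -> : (fun n => \sum_(i < n) (((a i.+1)%:R *+ 2) / 3 ^+ i.+1)) =
      (fun n => 3 * (\sum_(i < n.+1) (((a i)%:R *+ 2) / 3 ^+ i.+1)) - (a 0%N)%:R *+ 2) :> (nat -> R).
    apply/funext => n; rewrite big_ord_recl/= mulrDr expr1 mulrCA divff// mulr1.
    rewrite addrAC subrr add0r mulr_sumr; apply: eq_bigr => i _.
    by rewrite /bump/= add1n [in RHS]exprS invfM; field; rewrite expf_neq0.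
  apply: cvgB; last exact: cvg_cst.
  by apply: cvgMr; move: ak; rewrite -cvg_shiftS.
by case: (a 0%N); [right|left]; rewrite /= ?mulr2n; field.
Qed.

(** By induction: the two contractions k / 3 and (k + 2) / 3 double the number of intervals and
    divide their length by 3. The list [s] holds the left endpoints. *)
Lemma cantor_cover (n : nat) : exists s : seq R, size s = (2 ^ n)%N /\
  forall k, cantor k -> exists2 c, c \in s & c <= k <= c + 3^-1 ^+ n.
Proof.
elim: n => [|n [s [ss sP]]].
  exists [:: 0]; split=> // k /cantor_itv k01.
  by exists 0; rewrite ?inE// expr0 add0r.
exists ([seq c / 3 | c <- s] ++ [seq (c + 2) / 3 | c <- s]); split.
  by rewrite size_cat !size_map ss expnS mul2n addnn.
move=> k /cantor_tail[k' /sP[c cs /andP[ck kc]]]; rewrite exprS.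
set e := 3^-1 ^+ n in kc *.
case=> ->.
  exists (c / 3); first by rewrite mem_cat (map_f (fun c => c / 3)).
  by apply/andP; split; lra.
exists ((c + 2) / 3); first by rewrite mem_cat (map_f (fun c => (c + 2) / 3)) ?orbT.
by apply/andP; split; lra.
Qed.

End CantorCover.

(** * Convergence of series over integers and over pairs p < q *)

Section Series.
Variable R : realType.
Local Open Scope ereal_scope.

Lemma nneseries_le (u : nat -> \bar R) (B : \bar R) : (forall i, 0 <= u i) ->
  (forall n, \sum_(0 <= i < n) u i <= B) -> \sum_(i <oo) u i <= B.
Proof.
move=> u0 uB; apply: lime_le; first exact: is_cvg_nneseries.
exact: nearW.
Qed.

Local Open Scope ring_scope.

(* Convexity: [(1 - 1/x)^{-v} >= 1 + v/x], so each term of the series is dominated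
   by the telescoping difference [(x-1)^{-v} - x^{-v}]. *)
Lemma powR_telescope (v x : R) : 0 < v -> 1 < x ->
  v * x `^ (- (1 + v)) <= (x - 1) `^ (- v) - x `^ (- v).
Proof.
move=> v0 x1; have x0 : 0 < x by lra.
have y0 : 0 < x - 1 by lra.
have -> : x `^ (- (1 + v)) = x `^ (- v) * x^-1.
  by rewrite opprD addrC powRD ?(gt_eqF x0) ?implybT// powR_inv1// ltW.
suff : x `^ (- v) * (1 + v / x) <= (x - 1) `^ (- v) by rewrite mulrDr mulr1; lra.
have -> : x - 1 = x * (1 + - x^-1) by rewrite mulrDr mulr1 mulrN divff ?gt_eqF.
have xV : x^-1 < 1 by rewrite invf_lt1.
rewrite (powRM _ (ltW x0)); last by lra.
rewrite ler_pM2l ?powR_gt0// /powR gt_eqF; last by lra.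
apply: le_trans (expR_ge1Dx _); rewrite lerD2l mulNr -mulrN ler_pM2l//.
have : ln (1 + - x^-1) <= - x^-1 by apply: le_ln1Dx; lra.
by lra.
Qed.

Lemma zeta_lty (u : R) : 1 < u ->
  (\sum_(i <oo) (i%:R `^ (- u))%:E < +oo)%E.
Proof.
move=> u1; pose v := u - 1; have v0 : 0 < v by rewrite subr_gt0.
have uE : u = 1 + v by rewrite /v; lra.
(* Index 0 contributes 0 (a power of 0 with nonzero exponent), index 1 contributes 1, and the terms
   from 2 on telescope by [powR_telescope]. *)
have partial n : \sum_(0 <= i < n.+2) i%:R `^ (- u) <= 1 + (1 - n.+1%:R `^ (- v)) / v.
  elim: n => [|n IH].
    rewrite big_nat_recr//= big_nat1 powR0 ?add0r; last by lra.
    by rewrite !powR1 subrr mul0r addr0.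
  rewrite big_nat_recr//=; apply: le_trans (lerD IH (lexx _)) _.
  rewrite -addrA lerD2l -(ler_pM2r v0) mulrDl !mulfVK ?gt_eqF//.
  have := @powR_telescope v n.+2%:R v0; rewrite ltr1n => /(_ isT).
  by rewrite -uE -[n.+2%:R]natr1 addrK; lra.
apply: (@le_lt_trans _ _ (1 + v^-1)%:E); last exact: ltry.
apply: nneseries_le => [i|n]; first by rewrite lee_fin powR_ge0.
rewrite sumEFin lee_fin.
apply: (@le_trans _ _ (\sum_(0 <= i < n.+2) i%:R `^ (- u))).
  rewrite (big_cat_nat (n := n) (p := n.+2))//=; last by lia.
  by rewrite lerDl sumr_ge0// => *; exact: powR_ge0.
apply: le_trans (partial n) _; rewrite lerD2l ler_pdivrMr// mulVf ?gt_eqF//.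
Qed.

(** At most q values of p go with each q, so the inner sums are at most C q^(1-t), and t - 1 > 1. *)
Lemma esum_pairs_lty (C t : R) (g : nat * nat -> \bar R) : 0 <= C -> 2 < t ->
  (forall pq, 0 <= g pq)%E ->
  (forall pq, (g pq <= if (pq.1 < pq.2)%N then (C * pq.2%:R `^ (- t))%:E else 0)%E) ->
  (\esum_(pq in setT) g pq < +oo)%E.
Proof.
move=> C0 t2 g0 gC.
pose G (q p : nat) : \bar R := (if (p < q)%N then C * q%:R `^ (- t) else 0)%:E.
have G0 q p : (0 <= G q p)%E.
  by rewrite /G lee_fin; case: ifP => // _; rewrite mulr_ge0 ?powR_ge0.
apply: (@le_lt_trans _ _ (\esum_(pq in setT) G pq.2 pq.1)%E).
  apply: le_esum => pq _; apply: le_trans (gC pq) _.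
  by rewrite /G; case: ifP.
(* The coordinates are swapped so that the outer sum runs over q. *)
rewrite (@reindex_esum _ _ _ setT setT (fun pq => (pq.2, pq.1))); last first.
  split=> // [[a b] [c d] _ _ [-> ->]//|[a b] _].
  by exists (b, a).
have -> : [set: nat * nat] = (setT `*`` (fun=> setT))%classic.
  by apply/seteqP; split.
rewrite -(@esum_esum _ _ _ setT (fun=> setT) G)//.
have Gq q : (\esum_(p in setT) G q p <= (C * q%:R `^ (- (t - 1)))%:E)%E.
  rewrite -nneseries_esumT//; apply: nneseries_le => // n.
  rewrite sumEFin lee_fin.
  have -> : \sum_(0 <= p < n) (if (p < q)%N then C * q%:R `^ (- t) else 0) =
      C * q%:R `^ (- t) * (minn n q)%:R.
    elim: n => [|n IH]; first by rewrite big_nil min0n mulr0.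
    rewrite big_nat_recr//= IH; case: ltnP => nq.
      by rewrite (minn_idPl nq) -natr1 mulrDr mulr1.
    by rewrite (minn_idPr (leqW nq)) addr0.
  rewrite -mulrA ler_wpM2l//.
  case: q => [|q]; first by rewrite minn0 mulr0 powR_ge0.
  rewrite opprB addrC powRD ?pnatr_eq0 ?implybT// powRr1//.
  by rewrite ler_wpM2l ?powR_ge0// ler_nat geq_minr.
apply: (@le_lt_trans _ _ (\esum_(q in setT) (C * q%:R `^ (- (t - 1)))%:E)%E).
  exact: le_esum.
rewrite -nneseries_esumT; last by move=> q; rewrite lee_fin mulr_ge0 ?powR_ge0.
under eq_eseriesr do rewrite EFinM.
rewrite nneseriesZl//.
apply: lte_mul_pinfty; [by rewrite lee_fin|by []|by apply: zeta_lty; lra].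
Qed.

End Series.

(** * A weighted Borel-Cantelli lemma *)

Section WeightedBorelCantelli.
Context d (T : measurableType d) (R : realType) (mu : {measure set T -> \bar R}).
Local Open Scope ereal_scope.

(** The sum of the weighted indicators has integral equal to the given finite series, so it is
    finite almost everywhere. Weights 1 give the classical first Borel-Cantelli lemma. *)
Lemma ae_weighted_sum_lty (E : nat -> set T) (a : nat -> R) :
  (forall i, measurable (E i)) -> (forall i, (0 <= a i)%R) ->
  \sum_(i <oo) (a i)%:E * mu (E i) < +oo ->
  {ae mu, forall x, \sum_(i <oo) (a i * \1_(E i) x)%:E < +oo}.
Proof.
move=> mE a0 fin; pose f i x : \bar R := (a i * \1_(E i) x)%:E.
have f0 i x : 0 <= f i x by rewrite lee_fin mulr_ge0.
have mf i : measurable_fun [set: T] (f i).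
  apply/measurable_EFinP; apply: measurable_funM; first exact: measurable_cst.
  exact: measurable_indic.
have intf i : \int[mu]_x f i x = (a i)%:E * mu (E i).
  rewrite /f; under eq_integral do rewrite EFinM.
  rewrite ge0_integralZl_EFin//; last first.
    by apply/measurable_EFinP; exact: measurable_indic.
  by rewrite integral_indic// setIT.
have mS : measurable_fun [set: T] (fun x => \sum_(i <oo) f i x).
  by apply: ge0_emeasurable_sum => // k x _ _; exact: f0.
have S0 x : 0 <= \sum_(i <oo) f i x by exact: nneseries_ge0.
have : mu.-integrable [set: T] (fun x => \sum_(i <oo) f i x).
  apply/integrableP; split=> //.
  under eq_integral do rewrite gee0_abs//.
  rewrite integral_nneseries//.
  by under eq_eseriesr do rewrite intf.
move/integrable_ae => /(_ measurableT).
by apply: filterS => x /(_ I); rewrite ge0_fin_numE.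
Qed.

End WeightedBorelCantelli.

(** * Hausdorff measure of limsup sets *)

Section HausdorffLimsup.
Variable R : realType.

(* The tail of the covering family covers the limsup set with arbitrarily small cost;
   the members of diameter [> delta] are discarded, being finitely many. *)
Lemma hausdorff_limsup_eq0 (s : R) (A : set R) (U : nat -> set R) :
  (\sum_(i <oo) (cover_term s (U i))%:E < +oo)%E ->
  (forall x, A x -> infinite_set [set i | U i x]) ->
  (forall d, 0 < d -> finite_set [set i | d < tdiam (U i)]) ->
  hausdorff s A = 0%E.
Proof.
move=> Ufin AU Ud.
have c0 i : (0 <= (cover_term s (U i))%:E)%E by rewrite lee_fin cover_term_ge0.
have small d : 0 < d -> hausdorff_delta s d A = 0%E.
  move=> d0; apply/eqP; rewrite eq_le; apply/andP; split; last first.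
    apply: le_ereal_inf_tmp => _ [F _ <-]; apply: nneseries_ge0 => i _ _.
    by rewrite lee_fin cover_term_ge0.
  apply/lee_addgt0Pr => e e0; rewrite add0e.
  have := nneseries_tail_cvg Ufin (fun i _ => c0 i).
  move=> /fine_cvgP[Tfin /cvgr_lt/(_ _ e0) Tlt].
  have [N tailN] : exists N, (\sum_(N <= k <oo) (cover_term s (U k))%:E <= e%:E)%E.
    near \oo => N; exists N.
    rewrite -[leLHS]fineK ?lee_fin; last by near: N.
    by apply: ltW; near: N.
  pose F i := if (N <= i)%N && (tdiam (U i) <= d) then U i else set0.
  apply: (@le_trans _ _ (\sum_(0 <= i <oo) (cover_term s (F i))%:E)%E).
    apply: ereal_inf_lbound; exists F => //; split=> [x Ax|i]; last first.
      by rewrite /F; case: ifP => [/andP[]//|_]; rewrite tdiam_set0 ltW.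
    have [i [Uix]] : ([set i | U i x] `\` (`I_N `|` [set i | d < tdiam (U i)])) !=set0.
      apply: infinite_setN0; apply: infinite_setD; first exact: AU.
      by rewrite finite_setU; split; [exact: finite_II|exact: Ud].
    move=> /= /not_orP[/negP iN /negP di]; exists i => //.
    by rewrite /F -leqNgt in iN *; rewrite leNgt iN di.
  apply: le_trans tailN; apply: nneseries_le => [i|n].
    by rewrite lee_fin cover_term_ge0.
  apply: le_trans (nneseries_lim_ge n _) => //.
  rewrite (big_nat_widenl N 0)// [leRHS]big_mkcond/=; apply: lee_sum => i _.
  rewrite /F; case: (N <= i)%N => /=; last by rewrite cover_term_set0.
  by case: ifP => // _; rewrite cover_term_set0.
apply/eqP; rewrite eq_le; apply/andP; split.
  by apply: ge_ereal_sup => _ [d d0 <-]; rewrite small.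
apply: ereal_sup_ubound; exists 1; rewrite ?small//=.
Unshelve. all: by end_near. Qed.

End HausdorffLimsup.

(** * Dirichlet approximation and the lower bound on the exponent *)

Section Dirichlet.
Variable R : realType.
Implicit Types xi : R.

Lemma seq_pos_lower_bound (T : eqType) (f : T -> R) (s : seq T) :
  (forall x, x \in s -> 0 < f x) -> exists2 e, 0 < e & forall x, x \in s -> e <= f x.
Proof.
elim: s => [|y s IH] fs; first by exists 1.
have [x xs|e e0 es] := IH; first by rewrite fs// inE xs orbT.
exists (Num.min e (f y)).
  by rewrite lt_min e0 fs// inE eqxx.
by move=> x; rewrite inE ge_min => /predU1P[->|/es ->//]; rewrite lexx orbT.
Qed.

(** Pigeonhole: two of the N + 1 fractional parts of i xi, 0 <= i <= N, share one of the N bins of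
    length 1/N; q is the difference of their indices. *)
Lemma dirichlet_int xi (N : nat) : (0 < N)%N ->
  exists (q : nat) (p : int), (0 < q <= N)%N /\ `|q%:R * xi - p%:~R| < N%:R^-1.
Proof.
move=> N0.
have NR0 : 0 < N%:R :> R by rewrite ltr0n.
have bin_lt (i : 'I_N.+1) : (Num.truncn (N%:R * frac (i%:R * xi)) < N)%N.
  have /andP[f0 f1] := frac_ge0_lt1 (i%:R * xi).
  rewrite truncn_lt_nat ?mulr_ge0// -[ltRHS]mulr1 ltr_pM2l//.
pose bin (i : 'I_N.+1) : 'I_N := Ordinal (bin_lt i).
have : ~~ injectiveb bin.
  apply/injectiveP => /leq_card; rewrite !card_ord; lia.
move=> /injectivePn[i [j ij bij]].
wlog ltij : i j ij bij / (i < j)%N.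
  move=> H; have := ij; rewrite neq_ltn => /orP[|ji]; first exact: H.
  by apply: (H j i) => //; rewrite eq_sym.
exists (j - i)%N, (Num.floor (j%:R * xi) - Num.floor (i%:R * xi)); split.
  by have := ltn_ord j; lia.
have /andP[fi0 fi1] := frac_ge0_lt1 (i%:R * xi).
have /andP[fj0 fj1] := frac_ge0_lt1 (j%:R * xi).
have -> : (j - i)%:R * xi - (Num.floor (j%:R * xi) - Num.floor (i%:R * xi))%:~R =
    frac (j%:R * xi) - frac (i%:R * xi).
  by rewrite natrB ?(ltnW ltij)// intrD rmorphN/= /frac; ring.
have /(congr1 val)/= := bij; move: fi0 fj0.
set a := frac (i%:R * xi); set b := frac (j%:R * xi) => a0 b0 ab.
have /andP[a1 a2] := truncn_itv (mulr_ge0 (ltW NR0) a0).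
have /andP[b1 b2] := truncn_itv (mulr_ge0 (ltW NR0) b0).
rewrite -[ltRHS]mul1r ltr_pdivlMr// -[X in _ * X]gtr0_norm// -normrM mulrBl ltr_norml.
rewrite ab in a1 a2; rewrite -natr1 in a2 b2.
by apply/andP; split; lra.
Qed.

(** To obtain an admissible pair, p is reduced modulo q, which [tdist] does not see, and the
    fraction is put in lowest terms. The prescribed closeness e later produces infinitely many
    pairs. *)
Lemma dirichlet xi (e : R) : ~ is_rational xi -> 0 < e ->
  exists2 pq, good_pairs xi 2 pq & tdist xi (pq.1%:R / pq.2%:R) < e.
Proof.
move=> irr e0.
pose N := (Num.truncn e^-1).+1.
have Ne : N%:R^-1 < e.
  rewrite invf_plt ?posrE ?ltr0n//; exact: truncnS_gt.
have [q [p [/andP[q0 qN] qp]]] := @dirichlet_int xi N isT.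
pose p1 := `|(p %% q)%Z|%N; pose g := gcdn p1 q.
have p1E : p1%:Z = (p %% q)%Z by rewrite /p1 gez0_abs// modz_ge0//; lia.
have p1q : (p1 < q)%N by have := @ltz_pmod p q; rewrite -p1E; lia.
have g0 : (0 < g)%N by rewrite gcdn_gt0 q0 orbT.
have qR0 : 0 < q%:R :> R by rewrite ltr0n.
have gR0 : 0 < g%:R :> R by rewrite ltr0n.
have Eq : q = (q %/ g * g)%N by rewrite divnK// dvdn_gcdr.
have Ep : p1 = (p1 %/ g * g)%N by rewrite divnK// dvdn_gcdl.
have q'0 : (0 < q %/ g)%N by rewrite divn_gt0// dvdn_leq// dvdn_gcdr.
have q'R0 : 0 < (q %/ g)%N%:R :> R by rewrite ltr0n.
have dist : tdist xi ((p1 %/ g)%N%:R / (q %/ g)%N%:R) < (N%:R * q%:R)^-1.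
  have -> : (p1 %/ g)%N%:R / (q %/ g)%N%:R = p1%:R / q%:R :> R.
    rewrite [in RHS]Ep [in RHS]Eq !natrM; field; by rewrite !gt_eqF.
  apply: le_lt_trans (tdist_le _ _ (p %/ q)%Z) _.
  have pE : p%:~R = (p %/ q)%Z%:~R * q%:R + p1%:R :> R.
    by rewrite {1}(divz_eq p q) intrD intrM -p1E.
  have -> : xi - p1%:R / q%:R - (p %/ q)%Z%:~R = (q%:R * xi - p%:~R) / q%:R.
    by rewrite pE; field; rewrite gt_eqF.
  rewrite normrM normfV (gtr0_norm qR0) invfM ltr_pM2r ?invr_gt0//.
exists (p1 %/ g, q %/ g)%N => /=; last first.
  apply: lt_trans dist _; apply: le_lt_trans Ne; rewrite invfM.
  by rewrite ler_piMr ?invr_ge0// invf_le1// ler1n.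
split; first by rewrite /= ltn_divRL ?dvdn_gcdr// divnK ?dvdn_gcdl.
split; first by rewrite /= /coprime -(eqn_pmul2r g0) muln_gcdl !divnK ?dvdn_gcdl ?dvdn_gcdr// mul1n.
apply: lt_le_trans dist _ => /=.
(* The reduced denominator satisfies q / g <= q <= N, hence (q / g)^2 <= N q. *)
rewrite powRN lef_pV2 ?posrE ?mulr_gt0 ?powR_gt0 ?ltr0n//.
rewrite -[2]/(2%:R) powR_mulrn// expr2 -!natrM ler_nat.
by apply: leq_mul; rewrite ?(leq_trans (leq_div _ _)).
Qed.

(** Finitely many good pairs would stay at a positive distance e from the irrational xi, while
    [dirichlet] gives one closer than e. *)
Lemma irr_exp_ge2 xi : ~ is_rational xi -> (2%:E <= irr_exp xi)%E.
Proof.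
move=> irr; rewrite /irr_exp; case: pselect => // ?.
apply: ereal_sup_ubound; exists 2 => //.
case/finite_seqP => s sE.
pose f (pq : nat * nat) := tdist xi (pq.1%:R / pq.2%:R).
have fs pq : pq \in s -> 0 < f pq.
  move=> pqs; rewrite lt_neqAle tdist_ge0 andbT eq_sym; apply/eqP => d0.
  have [pq12 _] : good_pairs xi 2 pq by rewrite sE.
  have q0 : (0 < pq.2)%N by apply: leq_ltn_trans pq12.
  have [n] := tdistE xi (pq.1%:R / pq.2%:R); rewrite -/(f pq) d0 => /esym/normr0_eq0 E.
  apply: irr; exists (pq.1%:Z + n * pq.2%:Z), pq.2; split => //.
  rewrite intrD intrM; move/eqP: E; rewrite -addrA -opprD subr_eq0 => /eqP ->.
  by field; rewrite pnatr_eq0 -lt0n.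
have [e e0 es] := seq_pos_lower_bound fs.
have [pq good] := dirichlet irr e0; rewrite ltNge => /negP; apply; apply: es.
by move: good; rewrite sE.
Qed.

End Dirichlet.

(** * Measure of the angles whose rotated Cantor set meets a given ball *)

Section RotationCover.
Variable R : realType.
Implicit Types (alpha mu s : R) (pq : nat * nat).

(** It depends on no particular xi, so one sum over it controls the good pairs of all points of
    alpha + K at once. *)
Definition near_rot alpha mu : set (nat * nat) :=
  [set pq | (pq.1 < pq.2)%N /\ exists2 xi, rotCantor alpha xi &
            tdist xi (pq.1%:R / pq.2%:R) < pq.2%:R `^ (- mu)].

Lemma good_pairs_near_rot alpha mu xi :
  rotCantor alpha xi -> good_pairs xi mu `<=` near_rot alpha mu.
Proof. by move=> ? pq [? [_ ?]]; split=> //; exists xi. Qed.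

Lemma good_pairs_anti mu mu' xi : mu' <= mu ->
  good_pairs xi mu `<=` good_pairs xi mu'.
Proof.
move=> le_mu pq [pq12 [cop d]]; split=> //; split=> //.
apply: lt_le_trans d _; apply: ler_powR; last by rewrite lerN2.
by rewrite ler1n; exact: leq_ltn_trans pq12.
Qed.

Lemma seq_itv_cover (l : R) (s : seq R) : 0 <= l ->
  exists E : set R, [/\ measurable E,
    (lebesgue_measure E <= ((size s)%:R * l)%:E)%E &
    forall c x, c \in s -> c <= x <= c + l -> E x].
Proof.
move=> l0; elim: s => [|c s [E [mE lE Es]]].
  by exists set0; split; rewrite ?measure0 ?mul0r.
pose J := `[c, c + l]%classic; exists (J `|` E); split.
- by apply: measurableU => //; exact: measurable_itv.
- have JE : (lebesgue_measure (J `|` E) <= lebesgue_measure J + lebesgue_measure E)%E.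
    by apply: measureU2 => //; exact: measurable_itv.
  apply: (le_trans JE).
  rewrite [size _]/=.
  rewrite -natr1 mulrDl mul1r addrC EFinD leeD//.
  rewrite /J lebesgue_measure_itv/= lte_fin; case: ifP => _.
    by rewrite -EFinB addrAC subrr add0r.
  by rewrite lee_fin.
- move=> c' x; rewrite inE => /predU1P[->|c's] cx; last by right; exact: Es cx.
  by left; rewrite /J/= in_itv.
Qed.

(** Take n the integer part of log_3 x: then 2^n = 3^(n kappa) <= x^kappa, and x < 3^(n+1). *)
Lemma ternary_scale (x : R) : 1 <= x ->
  exists n : nat, 2 ^+ n <= x `^ kappa R /\ 3^-1 ^+ n <= 3 / x.
Proof.
move=> x1; have x0 : 0 < x by rewrite (lt_le_trans _ x1).
pose y := ln x / ln 3.
have y0 : 0 <= y by apply: divr_ge0; [exact: ln_ge0|exact/ltW/ln3_gt0].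
have xE : x = 3 `^ y.
  by rewrite /powR pnatr_eq0/= /y mulfVK ?gt_eqF ?ln3_gt0// lnK ?posrE.
have /andP[ny yn] := truncn_itv y0.
exists (Num.truncn y); set n := Num.truncn y in ny yn *; split.
  rewrite -powR_mulrn// -[X in X `^ _ <= _]powR3_kappa -powRrM xE -powRrM mulrC.
  by rewrite ler_powR ?ler1n// ler_wpM2r// kappa_ge0.
rewrite exprVn ler_pdivlMr// mulrC ler_pdivrMr ?exprn_gt0//.
by rewrite -exprS -powR_mulrn// xE ler_powR ?ler1n// ltW.
Qed.

(** If alpha + k is within 1/x = q^-mu of p/q modulo 1 and k lies in [c, c + 3^-n], then alpha lies
    in an interval of length 3^-n + 2/x determined by c and an integer shift. *)
Lemma near_rot_cover mu pq : 0 < mu ->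
  exists E : set R, [/\ measurable E,
    (lebesgue_measure E <=
      if (pq.1 < pq.2)%N then (20 * pq.2%:R `^ (- (mu * (1 - kappa R))))%:E else 0)%E &
    forall alpha, 0 <= alpha < 1 -> near_rot alpha mu pq -> E alpha].
Proof.
case: pq => p q /= mu0; case: ltnP => pq; last first.
  exists set0; split; rewrite ?measure0// => alpha _ [/=].
  by rewrite ltnNge pq.
have q1 : 1 <= q%:R :> R by rewrite ler1n (leq_ltn_trans _ pq).
have q0 : 0 < q%:R :> R by rewrite (lt_le_trans _ q1).
pose x : R := q%:R `^ mu.
have x1 : 1 <= x by have := ler_powR q1 (ltW mu0); rewrite powRr0.
have x0 : 0 < x by rewrite (lt_le_trans _ x1).
have rE : q%:R `^ (- mu) = x^-1 by rewrite powRN.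
have r1 : x^-1 <= 1 by rewrite invf_le1.
have [n [n2 n3]] := ternary_scale x1.
set e := 3^-1 ^+ n in n3.
have e0 : 0 <= e by rewrite exprn_ge0// invr_ge0.
have [s [ss sP]] := cantor_cover R n.
(* The balls around the lifts of p/q that are relevant to [0 <= alpha < 1] and
   [0 <= k <= 1] are those around p/q + j - 1 with [0 <= j < 4]. *)
pose t := [seq p%:R / q%:R + j%:R - 1 - c - e - x^-1 | c <- s, j <- iota 0 4].
have xV0 : 0 < x^-1 by rewrite invr_gt0.
have [|E [mE lE Et]] := @seq_itv_cover (e + 2 * x^-1) t; first by lra.
exists E; split=> //.
  apply: le_trans lE _; rewrite lee_fin size_allpairs size_iota ss natrM natrX.
  (* The constant 20 is 4 * 5: four shifts for each of the 2^n <= x^kappa intervals, each of length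
     at most 3/x + 2/x. *)
  apply: (@le_trans _ _ (x `^ kappa R * 4 * (5 * x^-1))).
    apply: ler_pM => //; [by lra|by rewrite ler_pM2r|by lra].
  have -> : q%:R `^ (- (mu * (1 - kappa R))) = x `^ kappa R * x^-1.
    rewrite mulrBr mulr1 opprB powRD; last by rewrite (gt_eqF q0) implybT.
    by rewrite powRrM rE.
  by rewrite le_eqVlt; apply/orP; left; apply/eqP; ring.
move=> alpha /andP[a0 a1] [_ [_ [_ [k Kk <-] <-]]] /=; rewrite rE.
have /andP[k0 k1] := cantor_itv Kk; have [c cs /andP[ck kc]] := sP _ Kk.
have [m ->] := tdistE (frac (alpha + frac k)) (p%:R / q%:R).
rewrite /frac.
set z1 := Num.floor k; set z2 := Num.floor _.
(* Both projections to the circle and the distance contribute an integer; only their sum matters. *)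
have [m' m'E] : exists m' : int, m' = m + z1 + z2 by exists (m + z1 + z2).
have -> : alpha + (k - z1%:~R) - z2%:~R - p%:R / q%:R - m%:~R =
    alpha + k - p%:R / q%:R - m'%:~R by rewrite m'E !intrD; ring.
rewrite ltr_norml => /andP[d1 d2].
have pq0 : 0 <= p%:R / q%:R :> R by rewrite divr_ge0.
have pq1 : p%:R / q%:R < 1 :> R by rewrite ltr_pdivrMr// mul1r ltr_nat.
(* Since alpha + k - p/q lies in (-1, 2) and 1/x <= 1, m' lies strictly between -2 and 3; the shift
   j - 1 is m'. *)
have m1 : -1 <= m'.
  have : (-2)%:~R < m'%:~R :> R by rewrite rmorphN/=; lra.
  by rewrite ltr_int; move: (m') => z; clear; lia.
have m2 : m' <= 2.
  have : m'%:~R < 3%:~R :> R by lra.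
  by rewrite ltr_int; move: (m') => z; clear; lia.
pose j := `|(m' + 1)%R|%N.
have jE : j%:R = m'%:~R + 1 :> R.
  by rewrite -[LHS]/(j%:Z%:~R) /j gez0_abs ?intrD//; move: m1; clear; lia.
apply: (Et (p%:R / q%:R + j%:R - 1 - c - e - x^-1)).
  by apply: allpairs_f => //; rewrite mem_iota /j; move: m1 m2; clear; lia.
by rewrite jE; rewrite -/e in kc; apply/andP; split; lra.
Qed.

Lemma nat_pairs_enum : exists e : nat -> nat * nat, set_bij setT setT e.
Proof.
by apply/card_set_bijP; rewrite card_eq_sym card_nat2.
Qed.

Lemma nneseries_enum (e : nat -> nat * nat) (g : nat * nat -> \bar R) :
  set_bij setT setT e -> (forall pq, 0 <= g pq)%E ->
  (\sum_(i <oo) g (e i) = \esum_(pq in setT) g pq)%E.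
Proof.
by move=> eb g0; rewrite (reindex_esum _ _ _ _ eb) nneseries_esumT.
Qed.

Lemma ae_near_rot_lty mu s : 0 < mu -> 2 < mu * (s + 1 - kappa R) ->
  {ae (@lebesgue_measure R), forall alpha, 0 <= alpha < 1 ->
    (\esum_(pq in near_rot alpha mu) (pq.2%:R `^ (- (mu * s)))%:E < +oo)%E}.
Proof.
move=> mu0 mus.
have [E /all_and3[mE lE hE]] := choice (fun pq => near_rot_cover pq mu0).
have [e eb] := nat_pairs_enum.
pose a pq : R := pq.2%:R `^ (- (mu * s)).
have a0 pq : 0 <= a pq by exact: powR_ge0.
have := @ae_weighted_sum_lty _ _ R (@lebesgue_measure R)
  (fun i => E (e i)) (fun i => a (e i)).
move=> /(_ (fun i => mE (e i)) (fun i => a0 (e i))).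
rewrite (@nneseries_enum e (fun pq => (a pq)%:E * lebesgue_measure (E pq))%E)//; last first.
  by move=> pq; rewrite mule_ge0// lee_fin.
have fin : (\esum_(pq in setT) (a pq)%:E * lebesgue_measure (E pq) < +oo)%E.
  apply: (@esum_pairs_lty _ 20 (mu * (s + 1 - kappa R))) => //.
    by move=> pq; rewrite mule_ge0// lee_fin.
  move=> [p q]; apply: le_trans (lee_wpmul2l _ (lE (p, q))) _; rewrite ?lee_fin//=.
  case: ltnP => pq; last by rewrite mule0.
  rewrite -EFinM lee_fin /a/= mulrCA -powRD; last first.
    by rewrite pnatr_eq0 -lt0n (leq_ltn_trans _ pq)// implybT.
  by rewrite (_ : - (mu * s) - _ = - (mu * (s + 1 - kappa R)))//; ring.
move=> /(_ fin); apply: filterS => alpha + alpha01.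
rewrite (@nneseries_enum e (fun pq => (a pq * \1_(E pq) alpha)%:E))//; last first.
  by move=> pq; rewrite lee_fin mulr_ge0.
(* A pair in [near_rot] forces alpha into [E pq], so its weight already occurs in the sum over all
   pairs. *)
apply: le_lt_trans; rewrite esum_mkcond; apply: le_esum => pq _.
case: ifPn => [|_]; last by rewrite lee_fin mulr_ge0.
by rewrite inE => /(hE _ _ alpha01) Ea; rewrite indicE mem_set// mulr1.
Qed.

End RotationCover.

(** * From summability to exponent and dimension bounds *)

Section Consequences.
Variable R : realType.
Implicit Types (alpha mu s : R).

Lemma esum1_lty_finite (T : choiceType) (A : set T) :
  (\esum_(x in A) (1%:E : \bar R) < +oo)%E -> finite_set A.
Proof.
move=> Afin; apply: contrapT => Ainf.
have card_le n : (n%:R%:E <= \esum_(x in A) (1%:E : \bar R))%E.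
  have [B BA nB] := infinite_set_fset n Ainf.
  move: BA; set X := (X in X `<=` A) => BA.
  have finX : finite_set X by exact: finite_fset.
  apply: esum_ge; exists X; first by split.
  rewrite fsbig_finite//= /X set_fsetK sumEFin lee_fin big_const_seq count_predT.
  by rewrite iter_addr addr0 ler_nat.
have S0 : (0 <= \esum_(x in A) (1%:E : \bar R))%E by exact: esum_ge0.
have := card_le (Num.truncn (fine (\esum_(x in A) (1%:E : \bar R))%E)).+1.
by rewrite -[leRHS]fineK ?ge0_fin_numE// lee_fin leNgt truncnS_gt.
Qed.

(** A rational xi has exponent 1, whence [1 <= mu]. The freedom to choose mu'' below mu' lets a
    rational exponent be used. *)
Lemma irr_exp_le alpha mu xi : 1 <= mu -> rotCantor alpha xi ->
  (forall mu', mu < mu' -> exists2 mu'', mu'' <= mu' & finite_set (near_rot alpha mu'')) ->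
  (irr_exp xi <= mu%:E)%E.
Proof.
move=> mu1 Kxi fin; rewrite /irr_exp; case: pselect => //= _.
apply: ge_ereal_sup => _ [mu' /= inf <-]; rewrite lee_fin leNgt; apply/negP => lt_mu.
have [mu'' le_mu fin''] := fin _ lt_mu.
apply: inf; apply: sub_finite_set fin''.
by apply: subset_trans (good_pairs_near_rot Kxi); exact: good_pairs_anti.
Qed.

(** The supremum defining the exponent may not be attained, hence the strict loss from mu to mu';
    [1 < mu] excludes rational points. *)
Lemma Mset_good_pairs mu mu' xi : 1 < mu -> mu' < mu -> Mset mu xi ->
  infinite_set (good_pairs xi mu').
Proof.
move=> mu1 lt_mu [_]; rewrite /irr_exp; case: pselect => /= [_|_].
  by rewrite lee_fin leNgt mu1.
move=> le_mu; have : (mu'%:E < ereal_sup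
    [set m%:E | m in [set m : R | infinite_set (good_pairs xi m)]])%E.
  by apply: lt_le_trans le_mu; rewrite lte_fin.
move=> /ereal_sup_gt[_ [m inf <-]]; rewrite lte_fin => /ltW lt_m.
exact: sub_infinite_set (good_pairs_anti lt_m) inf.
Qed.

Lemma tdiam_ball_le (c r : R) : 0 <= r -> tdiam [set x | tdist x c < r] <= 2 * r.
Proof.
move=> r0; apply: tdiam_le; first by rewrite mulr_ge0.
move=> x y /= xc yc; apply: le_trans (tdist_triangle c x y) _; lra.
Qed.

Lemma hausdorff_Mset_eq0 alpha mu mu' s : 1 < mu -> 0 < mu' < mu -> 0 <= s ->
  (\esum_(pq in near_rot alpha mu') (pq.2%:R `^ (- (mu' * s)))%:E < +oo)%E ->
  hausdorff s (Mset mu `&` rotCantor alpha) = 0%E.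
Proof.
move=> mu1 /andP[mu'0 lt_mu] s0 fin.
have [e eb] := nat_pairs_enum; have [_ e_inj e_surj] := eb.
pose r (pq : nat * nat) : R := pq.2%:R `^ (- mu').
have r0 pq : 0 <= r pq by exact: powR_ge0.
(* Balls missed by alpha + K are replaced by the empty set, of cost 0, so that the family is indexed
   by all pairs. *)
pose V pq := if pselect (near_rot alpha mu' pq) then
  [set x : R | tdist x (pq.1%:R / pq.2%:R) < r pq] else set0.
have VE pq : near_rot alpha mu' pq ->
    V pq = [set x : R | tdist x (pq.1%:R / pq.2%:R) < r pq].
  by rewrite /V; case: pselect.
have V0 pq : ~ near_rot alpha mu' pq -> V pq = set0.
  by rewrite /V; case: pselect.
apply: (@hausdorff_limsup_eq0 _ _ _ (V \o e)) => /=.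
- rewrite (@nneseries_enum _ e (fun pq => (cover_term s (V pq))%:E))//; last first.
    by move=> pq; rewrite lee_fin cover_term_ge0.
  apply: (@le_lt_trans _ _
    (\esum_(pq in setT) ((2 `^ s)%:E * if pq \in near_rot alpha mu' then
      (pq.2%:R `^ (- (mu' * s)))%:E else 0))%E).
    apply: le_esum => pq _; case: ifPn => [|/negP]; rewrite inE => npq; last first.
      by rewrite V0// cover_term_set0 mule0.
    rewrite -EFinM lee_fin VE// -mulNr powRrM -powRM// /cover_term.
    case: pselect => _ /=; first by rewrite powR_ge0.
    by rewrite ge0_ler_powR// ?nnegrE ?tdiam_ge0 ?mulr_ge0// tdiam_ball_le.
  rewrite -(nneseries_enum eb)//; last first.
    by move=> pq; case: ifP => _; rewrite ?mule0// -EFinM lee_fin mulr_ge0 ?powR_ge0.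
  rewrite nneseriesZl//; last by move=> i _; case: ifP => _; rewrite ?lee_fin ?powR_ge0.
  rewrite (@nneseries_enum _ e (fun pq => if pq \in near_rot alpha mu' then
      (pq.2%:R `^ (- (mu' * s)))%:E else 0)%E)//; last first.
    by move=> pq; case: ifP => _; rewrite ?lee_fin ?powR_ge0.
  rewrite -esum_mkcond; apply: lte_mul_pinfty => //.
- move=> x [/(Mset_good_pairs mu1 lt_mu) inf Kx] finx; apply: inf.
  apply: sub_finite_set (finite_image e finx) => pq good.
  have [i _ iE] := e_surj pq I; exists i => //=; rewrite iE VE.
    by case: good => _ [].
  exact: good_pairs_near_rot good.
- move=> d d0.
  (* A diameter above d forces d < 2 q^-mu', that is q < (2/d)^(1/mu'), which leaves finitely many
     pairs p < q. *)
  have [Q QE] : exists Q : nat, (2 / d) `^ mu'^-1 < Q%:R.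
    by exists (Num.truncn ((2 / d) `^ mu'^-1)).+1; exact: truncnS_gt.
  have finQ : finite_set [set pq : nat * nat | (pq.1 < Q)%N /\ (pq.2 < Q)%N].
    by apply: (finite_setX (finite_II Q) (finite_II Q)).
  apply: sub_finite_set (finite_preimage _ finQ) => [i /= di|]; last first.
    by move=> i j _ _; apply: e_inj; rewrite inE.
  have [npq|npq] := pselect (near_rot alpha mu' (e i)); last first.
    by move: di; rewrite V0// tdiam_set0 ltNge ltW.
  have pq12 := npq.1; have q0 : (0 < (e i).2)%N by exact: leq_ltn_trans pq12.
  suff qQ : ((e i).2 < Q)%N by split=> //; exact: ltn_trans qQ.
  rewrite -(ltr_nat R); apply: le_lt_trans QE.
  have q0R : 0 < (e i).2%:R :> R by rewrite ltr0n.
  have : d < 2 * r (e i) by apply: lt_le_trans di _; rewrite VE// tdiam_ball_le.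
  rewrite /r powRN ltr_pdivlMr ?powR_gt0// => h.
  have -> : (e i).2%:R = ((e i).2%:R `^ mu') `^ mu'^-1 :> R.
    by rewrite -powRrM mulfV ?gt_eqF// powRr1// ltW.
  apply: ge0_ler_powR; rewrite ?nnegrE ?powR_ge0 ?invr_ge0 ?divr_ge0 1?ltW//.
  by rewrite ltr_pdivlMr// mulrC.
Qed.

End Consequences.

(** * A single null set for all rational parameters, and the theorem *)

Lemma ae_forall_countable d (T : measurableType d) (R : realType)
    (mu : {measure set T -> \bar R}) (I : countType) (P : I -> T -> Prop) :
  (forall i, {ae mu, forall x, P i x}) -> {ae mu, forall x, forall i, P i x}.
Proof.
(* Numbers that encode no index get the trivial property. *)
move=> aeP; pose Q n x := if unpickle n is Some i then P i x else True.
have : {ae mu, forall x, forall n, Q n x}.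
  apply: ae_foralln => n; rewrite /Q; case: unpickle => [i|]; first exact: aeP.
  exact: filterE.
by apply: filterS => x Qx i; have := Qx (pickle i); rewrite /Q pickleK.
Qed.

Theorem theorem2p1 (R : realType) :
  {ae (@lebesgue_measure R), forall alpha : R, 0 <= alpha < 1 ->
     (forall xi : R, rotCantor alpha xi -> ~ is_rational xi ->
        (2%:E <= irr_exp xi <= (2 / (1 - kappa R))%:E)%E) /\
     (forall mu : R, 2 <= mu <= 2 / (1 - kappa R) ->
        (hdim (Mset mu `&` rotCantor alpha) <= (2 / mu + kappa R - 1)%:E)%E)}.
Proof.
have k0 := kappa_ge0 R; have k1 : 0 < 1 - kappa R by rewrite subr_gt0 kappa_lt1.
(* The conditions on (r, s) sit inside [P], so that it holds almost everywhere for every rational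
   pair, vacuously when they fail. *)
pose P (rs : rat * rat) (alpha : R) : Prop :=
  0 < ratr rs.1 :> R -> 2 < ratr rs.1 * (ratr rs.2 + 1 - kappa R) -> 0 <= alpha < 1 ->
  (\esum_(pq in near_rot alpha (ratr rs.1))
    ((pq.2%:R : R) `^ (- (ratr rs.1 * ratr rs.2)))%:E < +oo)%E.
have aeP rs : {ae (@lebesgue_measure R), forall alpha, P rs alpha}.
  case: rs => r s; rewrite /P/=.
  have [r0|r0] := ltP 0 (ratr r : R); last first.
    by apply: aeW.
  have [rs|rs] := ltP 2 (ratr r * (ratr s + 1 - kappa R)); last first.
    by apply: aeW.
  have := ae_near_rot_lty r0 rs; apply: filterS => [|alpha + _ _]; last exact.
  exact: (ae_filter_ringOfSetsType lebesgue_measure).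
have := ae_forall_countable aeP; apply: filterS => alpha fin alpha01; split.
  move=> xi Kxi irr; rewrite irr_exp_ge2//=.
  apply: (irr_exp_le _ Kxi); first by rewrite ler_pdivlMr// mul1r; lra.
  (* For s = 0 the summability condition reads r (1 - kappa) > 2, which is r > 2 / (1 - kappa). *)
  move=> mu lt_mu; have [r /[!in_itv]/= /andP[r1 r2]] := rat_in_itvoo lt_mu.
  exists (ratr r); first exact: ltW.
  apply: (@esum1_lty_finite R).
  have := fin (r, 0); rewrite /P/= rmorph0 mulr0 oppr0 add0r.
  under eq_esum do rewrite powRr0.
  apply => //; last by rewrite -ltr_pdivrMr.
  by apply: lt_trans r1; rewrite divr_gt0.
move=> mu /andP[mu2 muM]; have mu0 : 0 < mu by lra.
set D := 2 / mu + kappa R - 1.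
(* This is where mu <= 2 / (1 - kappa) enters: [hdim] is an infimum over nonnegative s only. *)
have D0 : 0 <= D.
  rewrite ler_pdivlMr// mulrC -ler_pdivlMr// in muM; rewrite /D; lra.
rewrite /hdim; case: pselect => [?|?]; first by rewrite leNye.
apply/lee_addgt0Pr => e e0; rewrite -EFinD.
have /rat_in_itvoo[s /[!in_itv]/= /andP[s1 s2]] : D < D + e by rewrite ltrDl.
have s0 : 0 <= ratr s :> R by exact: le_trans D0 (ltW s1).
have sk : 0 < ratr s + 1 - kappa R by lra.
(* This rearranges s > D; it leaves room for a rational r < mu with r (s + 1 - kappa) > 2. *)
have : 2 / (ratr s + 1 - kappa R) < mu.
  by rewrite ltr_pdivrMr// mulrC -ltr_pdivrMr//; rewrite /D in s1; lra.
move=> /rat_in_itvoo[r /[!in_itv]/= /andP[r1 r2]].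
have r0 : 0 < ratr r :> R by apply: lt_trans r1; rewrite divr_gt0.
apply: ge_ereal_inf; exists (ratr s)%:E; last by rewrite lee_fin ltW.
exists (ratr s) => //; split=> //.
apply: (@hausdorff_Mset_eq0 _ _ _ (ratr r)); rewrite ?r0 ?r2//; first lra.
by apply: (fin (r, s)) => //=; rewrite -ltr_pdivrMr.
Qed.
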